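(* Let a locally compact group $G$ act on a compactum $\Lambda$ with $|\Lambda|\ge 3$ properly on triples, and on a locally compact Hausdorff space $\Omega$ properly and cocompactly. Then on the disjoint union $\Omega\sqcup\Lambda$ there is a unique compact Hausdorff topology $\tau$ extending the original topologies of $\Lambda$ and $\Omega$ (i.e. inducing them as subspace topologies) such that the $G$-action on the space $X=(\Omega\sqcup\Lambda,\tau)$ is proper on triples.
   Context: A compactum is a compact Hausdorff space; locally compact groups are Hausdorff. All actions are continuous. A continuous action of a locally compact group $G$ on a locally compact Hausdorff space $L$ is proper if for every compact $K\subset L\times L$ the set $\{(g,p)\in G\times L:(p,gp)\in K\}$ is compact. An action on a compactum $T$ is proper on triples if the induced action on the space $\Theta^3T$ of three-element subsets of $T$ (topologized as a subspace of the quotient of $T^3$ by the symmetric group) is proper. An action of $G$ on $\Omega$ is cocompact if there is a compact $K\subset\Omega$ with $GK=\Omega$. The $G$-action on $\Omega\sqcup\Lambda$ is the union of the two given actions. *)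

(* Defs.v *)
From HB Require Import structures.
From mathcomp Require Import all_boot all_order all_fingroup.
From mathcomp Require Import generic_quotient.
From mathcomp Require Import all_classical topology.

Set Implicit Arguments.
Unset Strict Implicit.
Unset Printing Implicit Defensive.

Local Open Scope classical_set_scope.
Local Open Scope quotient_scope.

(* Multiplicative, not necessarily abelian; no separation axiom is built in. *)
HB.mixin Record isTopologicalGroup G & Topological G & monoid.Group G := {
  mulg_continuous : continuous (fun x : G * G => (x.1 * x.2)%g);
  invg_continuous : continuous (fun x : G => x^-1%g)
}.

#[short(type="topologicalGroupType")]
HB.structure Definition TopologicalGroup :=
  {G of isTopologicalGroup G & Topological G & monoid.Group G}.

Record gaction (G : groupType) (L : Type) := GAction {
  gact :> G -> L -> L;
  gact1 : forall p, gact 1%g p = p;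
  gactM : forall g h p, gact (g * h)%g p = gact g (gact h p)
}.

Lemma gact_inj (G : groupType) (L : Type) (a : gaction G L) (g : G) :
  injective (a g).
Proof. by move=> p q e; rewrite -(gact1 a p) -(gact1 a q) -(mulVg g) !gactM e. Qed.

Section Actions.
Context (G : topologicalGroupType) (L : topologicalType) (a : gaction G L).

Definition continuous_action := continuous (fun gp : G * L => a gp.1 gp.2).

(* Continuity is not part of this predicate; it is required separately. *)
Definition proper_action := forall K : set (L * L), compact K ->
  compact [set gp : G * L | K (gp.2, a gp.1 gp.2)].

Definition cocompact_action := exists K : set L,
  compact K /\ [set a g p | g in [set: G] & p in K] = [set: L].

End Actions.

Section Triples.
Context (T : topologicalType).

Definition triple_rel (x y : {ptws 'I_3 -> T}) : bool :=
  `[< exists s : {perm 'I_3}, y = x \o s >].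

Lemma triple_rel_refl : reflexive triple_rel.
Proof.
by move=> x; apply/asboolP; exists 1%g; apply/funext => i /=; rewrite perm1.
Qed.

Lemma triple_rel_sym : symmetric triple_rel.
Proof.
suff sub x y : triple_rel x y -> triple_rel y x.
  by move=> x y; apply/idP/idP; apply: sub.
move=> /asboolP[s ->]; apply/asboolP; exists s^-1%g.
by apply/funext => i /=; rewrite permKV.
Qed.

Lemma triple_rel_trans : transitive triple_rel.
Proof.
move=> y x z /asboolP[s ->] /asboolP[t ->]; apply/asboolP; exists (t * s)%g.
by apply/funext => i /=; rewrite permM.
Qed.

Definition triple_equiv :=
  EquivRel triple_rel triple_rel_refl triple_rel_sym triple_rel_trans.

(* The quotient T^3 / S_3; {ptws _} is the product topology on T^3. *)
Definition sym3 := quotient_topology {eq_quot triple_equiv}.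
HB.instance Definition _ := Topological.on sym3.
HB.instance Definition _ := Quotient.on sym3.

Lemma sym3_eqP (x y : {ptws 'I_3 -> T}) :
  \pi_sym3 x = \pi_sym3 y <-> exists s : {perm 'I_3}, y = x \o s.
Proof.
split=> [/eqmodP/asboolP //|[s e]]; apply/eqmodP/asboolP; by exists s.
Qed.

(* A three-element subset {t0, t1, t2} of T is encoded as the S_3-orbit of the
   triple (t0, t1, t2) of distinct points; the topology is the subspace one. *)
Definition theta3_set : set sym3 :=
  [set \pi_sym3 x | x in [set x : {ptws 'I_3 -> T} | injective x]].

Definition theta3 : topologicalType := theta3_set.

End Triples.

Arguments theta3_set : clear implicits.

Section Theta3Action.
Context (G : groupType) (T : topologicalType) (a : gaction G T).

Definition sym3_act (g : G) (q : sym3 T) : sym3 T :=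
  \pi_(sym3 T) ((a g \o repr q) : {ptws 'I_3 -> T}).

Lemma sym3_act_pi (g : G) (x : {ptws 'I_3 -> T}) :
  sym3_act g (\pi_(sym3 T) x) = \pi_(sym3 T) ((a g \o x) : {ptws 'I_3 -> T}).
Proof.
have /sym3_eqP[s e] : \pi_(sym3 T) (repr (\pi_(sym3 T) x)) = \pi_(sym3 T) x.
  by rewrite reprK.
by apply/sym3_eqP; exists s; apply/funext => i; rewrite /= {1}e.
Qed.

Lemma sym3_act_theta3 (g : G) (q : theta3 T) :
  sym3_act g (val q) \in theta3_set T.
Proof.
case: q => q /= /set_mem[x xi <-]; rewrite sym3_act_pi; apply/mem_set.
by exists (a g \o x) => //; apply: inj_comp => //; exact: gact_inj.
Qed.

Definition theta3_act (g : G) (q : theta3 T) : theta3 T :=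
  Sub (sym3_act g (val q)) (sym3_act_theta3 g q).

Lemma sym3_act1 (q : sym3 T) : sym3_act 1%g q = q.
Proof.
rewrite -[q]reprK sym3_act_pi; congr pi.
by apply/funext => i /=; rewrite gact1.
Qed.

Lemma sym3_actM (g h : G) (q : sym3 T) :
  sym3_act (g * h)%g q = sym3_act g (sym3_act h q).
Proof.
rewrite -[q]reprK !(sym3_act_pi _ (repr q)) sym3_act_pi; congr pi.
by apply/funext => i /=; rewrite gactM.
Qed.

Lemma theta3_act1 (q : theta3 T) : theta3_act 1%g q = q.
Proof. by apply: val_inj; exact: sym3_act1. Qed.

Lemma theta3_actM (g h : G) (q : theta3 T) :
  theta3_act (g * h)%g q = theta3_act g (theta3_act h q).
Proof. by apply: val_inj; exact: sym3_actM. Qed.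

Definition theta3_gaction : gaction G (theta3 T) :=
  GAction theta3_act1 theta3_actM.

End Theta3Action.

Definition proper_on_triples (G : topologicalGroupType) (T : topologicalType)
  (a : gaction G T) := proper_action (theta3_gaction a).

Section SumAction.
Context (G : groupType) (A B : Type) (a : gaction G A) (b : gaction G B).

Definition sum_act (g : G) (p : A + B) : A + B :=
  match p with inl x => inl (a g x) | inr y => inr (b g y) end.

Lemma sum_act1 (p : A + B) : sum_act 1%g p = p.
Proof. by case: p => x /=; rewrite gact1. Qed.

Lemma sum_actM (g h : G) (p : A + B) :
  sum_act (g * h)%g p = sum_act g (sum_act h p).
Proof. by case: p => x /=; rewrite gactM. Qed.

Definition sum_gaction : gaction G (A + B)%type := GAction sum_act1 sum_actM.

End SumAction.

(* Topologies on a fixed carrier, as first-class objects that can be compared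
   for equality; openness of set0 is the case D = set0 of the last axiom. *)
Record topology_on (T : Type) := TopologyOn {
  opens : set (set T);
  opensT : opens [set: T];
  opensI : setI_closed opens;
  opens_bigcup : forall D : set (set T),
    D `<=` opens -> opens (\bigcup_(U in D) U)
}.

Lemma topology_on_ext (T : Type) (tau sigma : topology_on T) :
  opens tau = opens sigma -> tau = sigma.
Proof.
case: tau => o oT oI oU; case: sigma => o' oT' oI' oU' /= e; subst o'.
by congr TopologyOn; exact: Prop_irrelevance.
Qed.

Definition topologized (T : Type) (tau : topology_on T) : Type := T.

Section Topologized.
Context (T : choiceType) (tau : topology_on T).

Lemma topologized_bigU (I : Type) (f : I -> set T) :
  (forall i, opens tau (f i)) -> opens tau (\bigcup_i f i).
Proof.
move=> fo; rewrite -(bigcup_image [set: I] f id).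
by apply: opens_bigcup => _ [i _ <-].
Qed.

HB.instance Definition _ := Choice.copy (topologized tau) T.
HB.instance Definition _ := @isOpenTopological.Build (topologized tau)
  (opens tau) (opensT tau) (@opensI _ tau) topologized_bigU.

Lemma open_topologized (U : set (topologized tau)) : open U = opens tau U.
Proof. by []. Qed.

End Topologized.

(* The topology of A is the one induced from X along f. *)
Definition induces (A X : topologicalType) (f : A -> X) :=
  forall U : set A, open U <-> exists2 V : set X, open V & f @^-1` V = U.

(* Main.v *)
Require Import Defs.
From mathcomp Require Import all_boot all_order all_fingroup.
From mathcomp Require Import generic_quotient.
From mathcomp Require Import all_classical topology.

Set Implicit Arguments.
Unset Strict Implicit.
Unset Printing Implicit Defensive.

Local Open Scope classical_set_scope.
Local Open Scope card_scope.
Local Open Scope quotient_scope.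

(** The whole argument is about ultrafilters of group elements that leave every
    compact subset of [G] (predicate [escaping]); such ultrafilters play the
    role of sequences tending to infinity.

    For an action on a compactum with at least three points, properness on
    triples is a convergence property: along an escaping ultrafilter the group
    elements collapse the complement of one point, the repeller, to one point,
    the attractor ([proper_convergence]).  The limits of the pairs (y, g y)
    form a relation that is total and onto and has no three disjoint edges,
    since three distinct limits moved to three distinct limits would trap the
    group elements in a compact set; such a relation lies in the union of a
    vertical and a horizontal line ([no_three_matching]).  Conversely, the
    convergence property implies properness on triples
    ([convergence_proper]): a triple with three distinct limits has two points
    away from the repeller, and their images merge.

    Let [K] be a compact set with [G K = Omega].  A point of [Omega] far away
    has the form [g k] with [g] far away and [k] in [K], and the topology sends
    it near the attractor of [g].  That is, [U] is open if its traces on [Omega]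
    and [Lambda] are open and, for every escaping ultrafilter on [G] with
    attractor in [U], the set [U] contains [g K] for almost all [g].  Every
    family of points along an ultrafilter then falls into one of three types
    ([attractor_sum_limits]), from which compactness, continuity of the action
    and the convergence property follow.  The point that needs a construction
    is the separation of two points of [Lambda] ([separated_inr]): if [g K] and
    [h K] meet, then [h] is [g] times an element of a compact set, so [g] and
    [h] have the same attractor unless both lie in a compact set.

    For uniqueness, apply the convergence property to a competing topology.
    Attractor and repeller must both lie in [Lambda], because [Lambda] is
    invariant and compact.  Hence [K] avoids the repeller and is carried to
    the attractor ([attractor_topology_finer]), so the competing topology is
    coarser than the one constructed, and two comparable compact Hausdorff
    topologies coincide. *)

(** * Ultrafilters *)

Section Ultrafilters.
Context (I : Type) (F : set_system I) (UF : UltraFilter F).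

Lemma ultra_notin (A : set I) : ~ F A -> F (~` A).
Proof. by move=> nFA; case: (in_ultra_setVsetC A UF). Qed.

Lemma ultra_fmap (J : Type) (f : I -> J) : UltraFilter (f @ F).
Proof.
split; first exact: fmap_proper_filter.
move=> H PH FH; rewrite eqEsubset; split => // A HA.
apply: contrapT => /ultra_notin FnA.
have : H (A `&` ~` A) by apply: filterI HA _; exact: FH.
by rewrite setICr; exact: filter_not_empty.
Qed.

Lemma ultra_exists (J : finType) (P : J -> set I) :
  F [set i | exists j, P j i] -> exists j, F (P j).
Proof.
move=> FP; apply: contrapT => nP.
have FnP : \forall i \near F, forall j, (~` P j) i.
  by apply: filter_forall => j; apply: ultra_notin => FPj; apply: nP; exists j.
have [i [[j Pji] /(_ j) nPji]] := filter_ex (filterI FP FnP).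
exact: nPji.
Qed.

Lemma ultra_compact_cvg (T : topologicalType) (A : set T) (f : I -> T) :
  compact A -> F (f @^-1` A) -> exists2 x, A x & f @ F --> x.
Proof.
rewrite compact_ultra => cA FA.
by have [x [Ax fx]] := cA _ (ultra_fmap f) FA; exists x.
Qed.

Lemma ultra_compactT_cvg (T : topologicalType) (f : I -> T) :
  compact [set: T] -> exists x : T, f @ F --> x.
Proof.
move=> cT; have [|x _ fx] := @ultra_compact_cvg T [set: T] f cT; last by exists x.
by rewrite preimage_setT; exact: filterT.
Qed.

End Ultrafilters.

Lemma continuous_at_ultra (S T : topologicalType) (f : S -> T) (x : S) :
  (forall F : set_system S, UltraFilter F -> F --> x -> f @ F --> f x) ->
  {for x, continuous f}.
Proof.
move=> fU U Ufx; apply: contrapT => nU.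
have PF : ProperFilter (filter_from (nbhs x) (fun V => V `\` f @^-1` U)).
  apply: filter_from_proper => [|V Vx].
    apply: filter_from_filter; first by exists setT; exact: filterT.
    move=> V W Vx Wx; exists (V `&` W); first exact: filterI.
    by move=> y [[Vy Wy] nUy]; split; split.
  apply: contrapT => /set0P/negP/negPn/eqP VU0; apply: nU.
  apply: filterS Vx => y Vy; apply: contrapT => nUy.
  by have : set0 y by rewrite -VU0.
have [F [UF sF]] := ultraFilterLemma PF.
have Fx : F --> x.
  by move=> V Vx; apply: sF; exists V => // y [].
have FU : F (f @^-1` U) by exact: fU Fx _ Ufx.
have FnU : F (~` (f @^-1` U)).
  by apply: sF; exists setT; [exact: filterT|move=> y []].
by have [y [? ?]] := filter_ex (filterI FU FnU).
Qed.

(** A reduction to one ultrafilter at a time: the complements in [A] of the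
    members of [D] generate a proper filter unless one of them is empty. *)
Lemma ultra_sub_directed (T : Type) (D : set (set T)) (A : set T) :
  D !=set0 ->
  (forall V W, D V -> D W -> exists2 Z, D Z & V `|` W `<=` Z) ->
  (forall F, UltraFilter F -> F A -> exists2 V, D V & F V) ->
  exists2 V, D V & A `<=` V.
Proof.
move=> [V0 DV0] dirD AD; apply: contrapT => nA.
have PF : ProperFilter (filter_from D (fun V => A `\` V)).
  apply: filter_from_proper => [|V DV].
    apply: filter_from_filter; first by exists V0.
    move=> V W DV DW; have [Z DZ VWZ] := dirD V W DV DW; exists Z => // x.
    by move=> [Ax nZx]; split; split => // Bx; apply: nZx; apply: VWZ;
      [left|right].
  apply: contrapT => /set0P/negP/negPn/eqP AV0; apply: nA; exists V => // x Ax.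
  by apply: contrapT => nVx; have : set0 x by rewrite -AV0.
have [F [UF sF]] := ultraFilterLemma PF.
have FA : F A by apply: sF; exists V0 => // x [].
have [V DV FV] := AD F UF FA.
have FnV : F (~` V) by apply: sF; exists V => // x [].
by have [x [? ?]] := filter_ex (filterI FV FnV).
Qed.

(** Locally: an ultrafilter containing [K] converges to a point of [K], hence
    contains the interior of a compact neighborhood of that point. *)
Lemma compact_sub_interior (T : topologicalType) (K : set T) :
  locally_compact [set: T] -> compact K ->
  exists2 C, compact C & K `<=` C^°.
Proof.
move=> lcT cK.
have [] := @ultra_sub_directed T
  [set V | exists2 C, compact C & V `<=` C^°] K; last first.
- by move=> V [C cC VC] KV; exists C => //; exact: subset_trans VC.
- move=> F UF FK; have [x Kx Fx] := ultra_compact_cvg UF (f := id) cK FK.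
  have [C + [cC _]] := lcT x I; rewrite withinET => Cx.
  exists C^°; first by exists C.
  exact: Fx (nbhs_interior Cx).
- move=> V W [B cB VB] [C cC WC]; exists (V `|` W) => //.
  exists (B `|` C); first exact: compactU.
  by move=> x [/VB|/WC]; apply: interiorS => ? ?; [left|right].
- by exists set0, set0; [exact: compact0|].
Qed.

Lemma cvg_ultra_hausdorff (T : topologicalType) (I : Type) (F : set_system I)
  (y : I -> T) (a b : T) : UltraFilter F -> hausdorff_space T ->
  y @ F --> a -> y @ F --> b -> a = b.
Proof. by move=> UF hT ya yb; exact: (@cvg_unique _ hT (y @ F) _ _ _ ya yb). Qed.

Lemma cvg_near_eq (I : Type) (F : set_system I) (T : topologicalType)
    (f g : I -> T) (x : T) : Filter F ->
  F [set i | f i = g i] -> g @ F --> x -> f @ F --> x.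
Proof.
move=> FF fg; apply: cvg_trans; apply: near_eq_cvg.
by apply: filterS fg => i ->.
Qed.

(** * Convergence of triples *)

Section PointwiseConvergence.
Context (J : eqType) (T : topologicalType).
Context (I : Type) (F : set_system I) {FF : Filter F}.

Lemma ptws_cvgP (y : I -> {ptws J -> T}) (x : {ptws J -> T}) :
  y @ F --> x <-> forall j, (fun i => y i j) @ F --> x j.
Proof.
split=> [yx j U Uxj|yx].
  exact: (yx (proj j @^-1` U)) (@proj_continuous J (fun=> T) j x U Uxj).
apply/cvg_sup => j U.
have /= -> := @nbhsE (initial_topology (fun f : J -> T => f j)) x.
case=> B [[C oC <-] Cxj] /filterS; apply; apply: yx.
exact: open_nbhs_nbhs.
Qed.

End PointwiseConvergence.

Section Triples.
Context (T : topologicalType).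
Local Notation T3 := {ptws 'I_3 -> T}.

Lemma comp_perm_continuous (s : {perm 'I_3}) :
  continuous (fun x : T3 => (x \o s : T3)).
Proof.
move=> x; apply/(ptws_cvgP (F := nbhs x)) => j.
exact: (@proj_continuous 'I_3 (fun=> T) (s j) x).
Qed.

(** Convergence in the quotient by a finite group lifts along ultrafilters:
    near the orbit of [x] some reordering of the representative is near [x],
    and an ultrafilter selects one of the six permutations once and for all. *)
Lemma sym3_ultra_lift (I : Type) (F : set_system I) (q : I -> sym3 T) (x : T3) :
  UltraFilter F -> q @ F --> \pi_(sym3 T) x ->
  exists2 y : I -> T3, (forall i, \pi_(sym3 T) (y i) = q i) & y @ F --> x.
Proof.
move=> UF qx.
suff [s sx] : exists s : {perm 'I_3}, (fun i => (repr (q i) \o s : T3)) @ F --> x.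
  exists (fun i => repr (q i) \o s) => // i.
  by rewrite -[RHS]reprK; apply/esym/sym3_eqP; exists s.
apply: contrapT => nlift.
have /choice[U Us] (s : {perm 'I_3}) : exists U : set T3,
    nbhs x U /\ ~ F [set i | U (repr (q i) \o s)].
  apply: contrapT => nU; apply: nlift; exists s => V Vx.
  by apply: contrapT => FV; apply: nU; exists V.
(* One neighborhood of x that serves for all six permutations, and its
   saturation W in the quotient. *)
have : \forall y \near x, forall s, U s y.
  exact: filter_forall (fun s => (Us s).1).
rewrite /prop_near1 nbhsE => -[V [oV Vx] VU].
pose W := [set p : sym3 T | exists s : {perm 'I_3}, V (repr p \o s)].
have piW z : W (\pi z) <-> exists s : {perm 'I_3}, V (z \o s).
  have /sym3_eqP[t e] : \pi_(sym3 T) z = \pi_(sym3 T) (repr (\pi_(sym3 T) z)).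
    by rewrite reprK.
  split=> -[s Vs].
    exists (s * t)%g; move: Vs; rewrite e; congr (V _).
    by apply/funext => i /=; rewrite permM.
  exists (s * t^-1)%g; move: Vs; rewrite e; congr (V _).
  by apply/funext => i /=; rewrite permM permKV.
have oW : open W.
  have -> : open W = open (\bigcup_(s in [set: {perm 'I_3}])
      (fun z : T3 => (z \o s : T3)) @^-1` V) :> Prop.
    rewrite {1}/open /= /quotient_open; congr open.
    apply/seteqP; split=> z /= => [/piW[s ?]|[s _ ?]]; first by exists s.
    by apply/piW; exists s.
  apply: bigcup_open => s _; apply: open_comp oV => y _.
  exact: comp_perm_continuous.
have FW : F [set i | exists s, U s (repr (q i) \o s)].
  have : F (q @^-1` W).
    apply: qx; apply: open_nbhs_nbhs; split=> //; apply/piW; exists 1%g.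
    by congr (V _) : Vx; apply/funext => i /=; rewrite perm1.
  by apply: filterS => i [s /VU Vs]; exists s.
by have [s Fs] := ultra_exists UF FW; case: (Us s).
Qed.

Lemma theta3_cvgP (I : Type) (F : set_system I) (FF : Filter F)
    (q : I -> theta3 T) (p : theta3 T) :
  q @ F --> p <-> (fun i => val (q i)) @ F --> val p.
Proof.
split=> [qp|qp U].
  apply: (@continuous_cvg _ _ _ F FF q val p) qp.
  exact: initial_continuous.
have /= -> := @nbhsE (initial_topology (val : theta3 T -> sym3 T)) p.
case=> B [[C oC <-] Cp] /filterS; apply; apply: qp.
exact: open_nbhs_nbhs.
Qed.

Lemma theta3P (p : theta3 T) :
  exists2 x : T3, injective x & \pi_(sym3 T) x = val p.
Proof. by case: p => q /= /set_mem[x]; exists x. Qed.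

Lemma theta3_ultra_lift (I : Type) (F : set_system I) (UF : UltraFilter F)
    (q : I -> theta3 T) (p : theta3 T) : q @ F --> p ->
  exists (y : I -> T3) (x : T3),
    [/\ forall i, \pi_(sym3 T) (y i) = val (q i),
        \pi_(sym3 T) x = val p, injective x & y @ F --> x].
Proof.
have [x xi xp] := theta3P p => /theta3_cvgP; rewrite -xp => qx.
by have [y yq yx] := sym3_ultra_lift UF qx; exists y, x.
Qed.

Lemma near_injective (x : T3) : hausdorff_space T -> injective x ->
  \forall y \near x, injective (y : T3).
Proof.
move=> hT xi; have Fx : Filter (nbhs x) by exact: (@nbhs_filter T3).
have sep j k : \forall y \near x, (y : T3) j = y k -> j = k.
  have [->|jk] := eqVneq j k; first exact: filterE.
  have xjk : x j != x k by apply: contra_neq jk => /xi.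
  move: (hT); rewrite open_hausdorff => /(_ _ _ xjk).
  move=> [[A B] /= [/set_mem Aj /set_mem Bk] [oA oB /eqP AB]].
  have nA : nbhs x (proj j @^-1` A).
    by apply: (@proj_continuous 'I_3 (fun=> T)); exact: open_nbhs_nbhs.
  have nB : nbhs x (proj k @^-1` B).
    by apply: (@proj_continuous 'I_3 (fun=> T)); exact: open_nbhs_nbhs.
  apply: filterS2 nA nB => y /= Ayj Byk e; exfalso.
  have : (A `&` B) ((y : T3) j) by split=> //; rewrite e.
  by rewrite AB.
have := @filter_forall T3 ('I_3 * 'I_3)%type
  (fun jk y => y jk.1 = y jk.2 -> jk.1 = jk.2) (nbhs x) Fx
  (fun jk => sep jk.1 jk.2).
by apply: filterS => y yi j k; exact: (yi (j, k)).
Qed.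

(** Local compactness of the space of three-element subsets of a compactum,
    expressed upstairs: the image of a closed neighborhood of [x] that consists
    of triples of distinct points. *)
Lemma near_theta3_compact (x : T3) :
  hausdorff_space T -> compact [set: T] -> injective x ->
  exists2 C : set (theta3 T), compact C &
    \forall y \near x, injective (y : T3) /\
      forall q : theta3 T, \pi_(sym3 T) y = val q -> C q.
Proof.
move=> hT cT xi.
have hT3 : hausdorff_space T3.
  exact: (@hausdorff_product 'I_3 (fun=> T)).
have cT3 : compact [set: T3].
  have := @tychonoff 'I_3 (fun=> T) (fun=> setT) (fun=> cT).
  by congr compact; apply/seteqP; split.
have := compact_regular hT3 cT3 (filterT : nbhs x _) (near_injective hT xi).
move=> [B Bx clB].
exists [set q | exists2 y, closure B y & \pi_(sym3 T) y = val q]; last first.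
  apply: filterS Bx => y By; split; first by apply: clB; exact: subset_closure.
  by move=> q yq; exists y => //; exact: subset_closure.
rewrite compact_ultra => F UF FC.
have /choice[y yP] (q : theta3 T) : exists y : T3,
    (exists2 z, closure B z & \pi_(sym3 T) z = val q) ->
    closure B y /\ \pi_(sym3 T) y = val q.
  case: (pselect (exists2 z, closure B z & \pi_(sym3 T) z = val q)).
    by move=> [z]; exists z.
  by move=> nq; exists x.
have cB : compact (closure B).
  exact: subclosed_compact (@closed_closure _ B) cT3 (@subsetT _ _).
have [z Bz yz] : exists2 z, closure B z & y @ F --> z.
  apply: (ultra_compact_cvg UF cB).
  by apply: filterS FC => q /yP[].
have pz : \pi_(sym3 T) z \in theta3_set T.
  by apply/mem_set; exists z => //; exact: clB.
exists (Sub (\pi_(sym3 T) z) pz); split; first by exists z.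
apply: (proj2 (@theta3_cvgP _ F _ id _)) => /=.
have piyz : (fun q => \pi_(sym3 T) (y q)) @ F --> \pi_(sym3 T) z.
  by apply: (@continuous_cvg _ _ _ F _ y _ z) yz; exact: pi_continuous.
apply: cvg_trans piyz; apply: near_eq_cvg.
by apply: filterS FC => q /yP[].
Qed.

End Triples.

(** * Three points and relations without three disjoint edges *)

Section ThreePoints.
Context (T : eqType).

Lemma nth3_inj (a b c : T) : a != b -> a != c -> b != c ->
  injective (fun i : 'I_3 => nth a [:: a; b; c] i).
Proof.
move=> ab ac bc i j /eqP; rewrite nth_uniq //=; first by move/eqP/val_inj.
by rewrite !inE negb_or ab ac bc.
Qed.

Context (p : 'I_3 -> T) (p_inj : injective p).

Lemma two_of_three (a : T) : exists i j : 'I_3,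
  [/\ i != j, p i != a & p j != a].
Proof.
have [[k <-]|na] := pselect (exists k, p k = a); last first.
  exists ord0, ord_max; split=> //; apply/eqP => e; apply: na.
    by exists ord0.
  by exists ord_max.
exists (lift k (@ord0 1)), (lift k ord_max); split;
  rewrite ?(inj_eq p_inj) 1?eq_sym.
- by rewrite (inj_eq lift_inj).
- exact: neq_lift.
- exact: neq_lift.
Qed.

Lemma one_of_three (a b : T) : exists i : 'I_3, p i != a /\ p i != b.
Proof.
have [i [j [ij ia ja]]] := two_of_three a.
have [ib|] := eqVneq (p i) b; last by exists i.
by exists j; rewrite ja -ib (inj_eq p_inj) eq_sym.
Qed.

(** The instance of Koenig's theorem for matchings of size at most two: such a
    relation is covered by two lines, and since it is total and onto a type
    with at least three elements, the two lines cannot be parallel. *)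
Lemma no_three_matching (R : T -> T -> Prop) :
  (forall x, exists z, R x z) -> (forall z, exists x, R x z) ->
  (forall x z : 'I_3 -> T, (forall i, R (x i) (z i)) -> injective x ->
     ~ injective z) ->
  exists a r, forall x z, R x z -> x = r \/ z = a.
Proof.
move=> Rl Rr nR.
have nR3 x1 x2 x3 z1 z2 z3 : R x1 z1 -> R x2 z2 -> R x3 z3 ->
    x1 != x2 -> x1 != x3 -> x2 != x3 ->
    z1 != z2 -> z1 != z3 -> z2 != z3 -> False.
  move=> R1 R2 R3 x12 x13 x23 z12 z13 z23.
  apply: nR (nth3_inj x12 x13 x23) (nth3_inj z12 z13 z23) => -[].
  by case=> [|[|[|//]]].
(* The horizontal line is the value a hit twice by the three points p. *)
have [a [q1 [q2 [q12 R1 R2]]]] : exists a q1 q2, [/\ q1 != q2, R q1 a & R q2 a].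
  have /choice[z Rz] i := Rl (p i).
  apply: contrapT => na; apply: (nR p z Rz p_inj) => i j zij.
  apply: contrapT => /eqP ij; apply: na; exists (z i), (p i), (p j).
  by rewrite (inj_eq p_inj) {2}zij.
have [q3 [q31 q32]] : exists q3, q3 != q1 /\ q3 != q2.
  by have [i] := one_of_three q1 q2; exists (p i).
(* Two edges whose heights are distinct and differ from a have the same foot,
   which gives the vertical line.  Otherwise the edge from q1 or q2 to a is
   disjoint from both, unless the two feet are q1 and q2; in that case an edge
   at q3 completes three disjoint edges. *)
have same x x' z z' : R x z -> R x' z' -> z != z' -> z != a -> z' != a -> x = x'.
  move=> Rx Rx' zz' za z'a; apply/eqP; apply: contraT => xx'.
  have q_in q : R q a -> (q == x) || (q == x').
    move=> Rq; apply: contraT; rewrite negb_or => /andP[qx qx'].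
    by case: (nR3 x x' q z z' a); rewrite // eq_sym.
  wlog [e1 e2] : x x' z z' Rx Rx' zz' za z'a xx' q_in / x = q1 /\ x' = q2.
    move=> main; case/orP: (q_in _ R1) => /eqP e1;
      case/orP: (q_in _ R2) => /eqP e2.
    - by rewrite e1 e2 eqxx in q12.
    - exact: (main x x' z z').
    - apply: (main x' x z' z) => //; try by rewrite eq_sym.
      by move=> q /q_in; rewrite orbC.
    - by rewrite e1 e2 eqxx in q12.
  subst x x'; have [w Rw] := Rl q3.
  have wa : w != a.
    apply: contraT => /negbNE/eqP wa; rewrite wa in Rw.
    by have := q_in _ Rw; rewrite (negbTE q31) (negbTE q32).
  have [wz|wz] := eqVneq w z; last by case: (nR3 q3 q1 q2 w z a).
  have wz' : w != z' by rewrite wz.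
  by case: (nR3 q3 q2 q1 w z' a); rewrite // eq_sym.
have [i [j [ij ia ja]]] := two_of_three a.
have zij : p i != p j by rewrite (inj_eq p_inj).
have [r Rri] := Rr (p i); have [r' Rrj] := Rr (p j).
have e := same _ _ _ _ Rri Rrj zij ia ja; subst r'.
exists a, r => x z Rxz; have [->|za] := eqVneq z a; [by right|left].
have [zi|zi] := eqVneq z (p i); last exact: same Rxz Rri zi za ia.
by apply: same Rxz Rrj _ za ja; rewrite zi.
Qed.

End ThreePoints.

(** * The convergence property *)

Section Escaping.
Context (G : topologicalGroupType).

(** An ultrafilter that is not escaping contains a compact set and so converges
    in [G] ([not_escaping]). *)
Definition escaping (I : Type) (F : set_system I) (g : I -> G) :=
  forall Q : set G, compact Q -> ~ F (g @^-1` Q).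

Lemma not_escaping (I : Type) (F : set_system I) (g : I -> G) :
  UltraFilter F -> ~ escaping F g -> exists h : G, g @ F --> h.
Proof.
move=> UF; apply: contra_notP => ng Q cQ FQ; apply: ng.
by have [h _ gh] := ultra_compact_cvg UF cQ FQ; exists h.
Qed.

(** Here [x] is the attractor and [r] the repeller.  Moving points [y] rather
    than fixed ones makes this the analogue of locally uniform convergence away
    from [r]. *)
Definition collapses (T : topologicalType) (a : gaction G T) (I : Type)
    (F : set_system I) (g : I -> G) (x r : T) :=
  forall (y : I -> T) (y0 : T), y @ F --> y0 -> y0 <> r ->
    (fun i => a (g i) (y i)) @ F --> x.

Definition convergence_property (T : topologicalType) (a : gaction G T) :=
  forall (I : Type) (F : set_system I) (g : I -> G), UltraFilter F ->
    escaping F g -> exists x r, collapses a F g x r.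

Context (T : topologicalType) (a : gaction G T).
Context (hT : hausdorff_space T) (ca : continuous_action a).

Lemma act_cvg (I : Type) (F : set_system I) (g : I -> G) (h : G)
    (y : I -> T) (x : T) : Filter F -> g @ F --> h -> y @ F --> x ->
  (fun i => a (g i) (y i)) @ F --> a h x.
Proof.
move=> FF gh yx.
apply: (@continuous_cvg _ _ _ F _ (fun i => (g i, y i))
  (fun gp => a gp.1 gp.2) (h, x)); [exact: ca|exact: cvg_pair].
Qed.

(** Properness applied to compact neighborhoods of the two limit triples. *)
Lemma proper_not_escaping (I : Type) (F : set_system I) (g : I -> G)
    (y : I -> {ptws 'I_3 -> T}) (x w : {ptws 'I_3 -> T}) :
  UltraFilter F -> compact [set: T] -> proper_on_triples a ->
  injective x -> injective w -> y @ F --> x ->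
  (fun i => (a (g i) \o y i : {ptws 'I_3 -> T})) @ F --> w ->
  ~ escaping F g.
Proof.
move=> UF cT pT xi wi yx gyw.
have [C cC Cx] := near_theta3_compact hT cT xi.
have [D cD Dw] := near_theta3_compact hT cT wi.
have := pT _ (compact_setX cC cD).
set M := [set gp | _] => cM.
have cMG : compact (fst @` M).
  apply: continuous_compact cM; apply: continuous_subspaceT => z.
  exact: cvg_fst.
move=> /(_ _ cMG); apply.
have FC := yx _ Cx; have FD := gyw _ Dw.
rewrite !nbhs_simpl /= in FC FD; apply: filterS2 FC FD => i [yi Cy] [gyi Dgy].
have py : \pi_(sym3 T) (y i) \in theta3_set T by apply/mem_set; exists (y i).
exists (g i, Sub (\pi_(sym3 T) (y i)) py) => //; split=> /=.
  exact: Cy.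
by apply: Dgy => /=; rewrite sym3_act_pi.
Qed.

(** [no_three_matching] for the relation formed by the limits of the pairs
    (y, g y).  It is onto because [g^-1 z] has a limit for each fixed [z]. *)
Lemma proper_convergence (p : 'I_3 -> T) : injective p ->
  compact [set: T] -> proper_on_triples a -> convergence_property a.
Proof.
move=> pi cT pT I F g UF eg.
pose R (x z : T) := exists y : I -> T,
  y @ F --> x /\ (fun i => a (g i) (y i)) @ F --> z.
have [||y w /choice[u Ru] yi wi|x [r Rr]] := @no_three_matching T p pi R.
- move=> x; have [z gz] := ultra_compactT_cvg UF (fun i => a (g i) x) cT.
  by exists z, (fun=> x); split=> //; exact: cvg_cst.
- move=> z; have [x gx] := ultra_compactT_cvg UF (fun i => a (g i)^-1%g z) cT.
  exists x, (fun i => a (g i)^-1%g z); split=> //.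
  have -> : (fun i => a (g i) (a (g i)^-1%g z)) = cst z.
    by apply/funext => i; rewrite -Defs.gactM mulgV Defs.gact1.
  exact: cvg_cst.
- apply: (@proper_not_escaping I F g (fun i j => u j i) y w) => //.
    by apply/ptws_cvgP => j; case: (Ru j).
  by apply/ptws_cvgP => j; case: (Ru j).
- exists x, r => y y0 yy0 y0r.
  have [z gz] := ultra_compactT_cvg UF (fun i => a (g i) (y i)) cT.
  by have /(Rr y0 z)[/y0r|<-] : R y0 z by exists y.
Qed.

(** Along an ultrafilter for which a triple [q] and its image [g q] both
    converge, [g] cannot escape: at least two of the three limit points differ
    from the repeller, so their images would have the same limit. *)
Lemma convergence_proper : convergence_property a -> proper_on_triples a.
Proof.
move=> conv K cK; rewrite compact_ultra => F UF FM.
pose g (i : G * theta3 T) := i.1; pose q (i : G * theta3 T) := i.2.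
have [[q0 q1] K01 qgq] := ultra_compact_cvg UF
  (f := fun i => (q i, theta3_gaction a (g i) (q i))) cK FM.
have qq0 : q @ F --> q0 by exact: cvg_comp qgq (cvg_fst (G := nbhs q1)).
have gqq1 : (fun i => theta3_gaction a (g i) (q i)) @ F --> q1.
  exact: cvg_comp qgq (cvg_snd (F := nbhs q0)).
have [y [x [yq xq0 xi yx]]] := theta3_ultra_lift UF qq0.
have [z [w [zq wq1 wi zw]]] := theta3_ultra_lift UF gqq1.
(* The lifts of q and of its image need not be ordered in the same way; the
   permutation s makes them agree. *)
have zgy i : exists s : {perm 'I_3}, a (g i) \o y i = z i \o s.
  by apply/sym3_eqP; rewrite zq /= -yq sym3_act_pi.
have [s Fs] := ultra_exists UF (filterE (F := F) _ zgy).
have gyw : (fun i => (a (g i) \o y i : {ptws 'I_3 -> T})) @ F -->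
    (w \o s : {ptws 'I_3 -> T}).
  apply: cvg_near_eq (_ : (fun i => (z i \o s : {ptws 'I_3 -> T})) @ F --> _).
    exact: Fs.
  exact: (@continuous_cvg _ _ _ F _ z _ w (@comp_perm_continuous T s w)).
have gyws j : (fun i => a (g i) (y i j)) @ F --> w (s j).
  by move/ptws_cvgP : gyw; exact.
have yxj j : (fun i => y i j) @ F --> x j by move/ptws_cvgP : yx; exact.
have [h gh] : exists h : G, g @ F --> h.
  apply: not_escaping => eg; have [l [r lr]] := conv _ _ _ UF eg.
  have [j [k [jk jr kr]]] := two_of_three xi r.
  have wl i : x i != r -> w (s i) = l.
    move=> /eqP ir; apply: (cvg_ultra_hausdorff UF hT (gyws i)).
    exact: lr (yxj i) ir.
  by move/eqP: jk; apply; apply/(@perm_inj _ s)/wi; rewrite !wl.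
have ahx : a h \o x = w \o s.
  apply/funext => j; apply: (cvg_ultra_hausdorff UF hT _ (gyws j)).
  exact: act_cvg gh (yxj j).
have hq0 : theta3_gaction a h q0 = q1.
  apply: val_inj; rewrite /= -xq0 sym3_act_pi ahx -wq1.
  by apply/esym/sym3_eqP; exists s.
exists (h, q0); split.
  by rewrite /= -[theta3_act _ _ _]/(theta3_gaction a h q0) hq0.
apply: cvg_trans (cvg_pair gh qq0) => A /=; rewrite !nbhs_simpl /=.
by apply: filterS => -[].
Qed.

End Escaping.

(** * Attractors *)

Section Attraction.
Context (G : topologicalGroupType) (L : topologicalType) (a : gaction G L).
Context (hL : hausdorff_space L) (ca : continuous_action a).
Context (p : 'I_3 -> L) (p_inj : injective p).
Context (conv : convergence_property a).

(** For an escaping ultrafilter this says that [l] is the attractor, without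
    mention of the repeller: two points suffice because at most one of them is
    the repeller ([attracted_collapses]).  Conversely it forces escape, since
    each group element is injective ([attracted_escaping]). *)
Definition attracted (I : Type) (F : set_system I) (g : I -> G) (l : L) :=
  exists x y, [/\ x != y, (fun i => a (g i) x) @ F --> l
    & (fun i => a (g i) y) @ F --> l].

Context (I : Type) (F : set_system I) (UF : UltraFilter F).
Implicit Types (g h q : I -> G) (l r : L).

Lemma attracted_escaping g l : attracted F g l -> escaping F g.
Proof.
move=> [x [y [xy gx gy]]]; apply: contrapT => /(not_escaping UF)[h gh].
move/eqP: xy; apply; apply: (@gact_inj _ _ a h).
have lim z : (fun i => a (g i) z) @ F --> a h z.
  exact: (act_cvg ca (y := fun=> z) _ gh (cvg_cst z)).
by rewrite (cvg_ultra_hausdorff UF hL (lim x) gx)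
  (cvg_ultra_hausdorff UF hL (lim y) gy).
Qed.

Lemma collapses_attracted g l r : collapses a F g l r -> attracted F g l.
Proof.
move=> glr; have [i [j [ij ir jr]]] := two_of_three p_inj r.
exists (p i), (p j); split; first by rewrite (inj_eq p_inj).
  exact: glr (cvg_cst _) (elimN eqP ir).
exact: glr (cvg_cst _) (elimN eqP jr).
Qed.

Lemma attracted_collapses g l :
  attracted F g l -> exists r, collapses a F g l r.
Proof.
move=> gl; have [m [r gmr]] := conv UF (attracted_escaping gl); exists r.
suff <- : m = l by [].
case: gl => x [y [xy gx gy]].
have [xr|/eqP xr] := eqVneq x r; last first.
  exact: cvg_ultra_hausdorff UF hL (gmr _ _ (cvg_cst x) xr) gx.
have /eqP yr : y != r by rewrite -xr eq_sym.
exact: cvg_ultra_hausdorff UF hL (gmr _ _ (cvg_cst y) yr) gy.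
Qed.

Lemma escaping_attracted g : escaping F g -> exists l, attracted F g l.
Proof.
move=> eg; have [l [r glr]] := conv UF eg.
by exists l; exact: collapses_attracted glr.
Qed.

Lemma attracted_mull g h (h0 : G) l : h @ F --> h0 -> attracted F g l ->
  attracted F (fun i => h i * g i)%g (a h0 l).
Proof.
move=> hh [x [y [xy gx gy]]]; exists x, y; split=> //.
  have -> : (fun i => a (h i * g i)%g x) = (fun i => a (h i) (a (g i) x)).
    by apply/funext => i; rewrite Defs.gactM.
  exact: act_cvg hh gx.
have -> : (fun i => a (h i * g i)%g y) = (fun i => a (h i) (a (g i) y)).
  by apply/funext => i; rewrite Defs.gactM.
exact: act_cvg hh gy.
Qed.

Lemma attracted_mulr g q l r (x y x0 y0 : L) : collapses a F g l r ->
  x != y -> (fun i => a (q i) x) @ F --> x0 -> x0 <> r ->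
  (fun i => a (q i) y) @ F --> y0 -> y0 <> r ->
  attracted F (fun i => g i * q i)%g l.
Proof.
move=> glr xy qx x0r qy y0r; exists x, y; split=> //.
  have -> : (fun i => a (g i * q i)%g x) = (fun i => a (g i) (a (q i) x)).
    by apply/funext => i; rewrite Defs.gactM.
  exact: glr qx x0r.
have -> : (fun i => a (g i * q i)%g y) = (fun i => a (g i) (a (q i) y)).
  by apply/funext => i; rewrite Defs.gactM.
exact: glr qy y0r.
Qed.

(** Right multiplication by a convergent family moves the three points [p] to
    three points with distinct limits, two of which are not the repeller. *)
Lemma collapses_mulr_cvg g q (q0 : G) l r : collapses a F g l r ->
  q @ F --> q0 -> attracted F (fun i => g i * q i)%g l.
Proof.
move=> glr qq.
have q0p_inj : injective (a q0 \o p) by apply: inj_comp p_inj; exact: gact_inj.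
have [i [j [ij ir jr]]] := two_of_three q0p_inj r.
have lim z : (fun i => a (q i) z) @ F --> a q0 z.
  exact: (act_cvg ca (y := fun=> z) _ qq (cvg_cst z)).
apply: (attracted_mulr glr (x := p i) (y := p j) _ (lim _) _ (lim _)).
- by rewrite (inj_eq p_inj).
- exact: elimN eqP ir.
- exact: elimN eqP jr.
Qed.

(** A test on a single [g] for having its attractor near [C]: when [g] is far
    away, two of the three points [p] are sent close to the attractor. *)
Definition majority (C : set L) (g : G) :=
  exists i j, [/\ i != j, C (a g (p i)) & C (a g (p j))].

Lemma near_majority g l (C : set L) :
  attracted F g l -> nbhs l C -> F [set i | majority C (g i)].
Proof.
move=> /attracted_collapses[r glr] Cl.
have [j [k [jk jr kr]]] := two_of_three p_inj r.
have Cj : F [set i | C (a (g i) (p j))].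
  exact: (glr _ _ (cvg_cst (p j)) (elimN eqP jr) _ Cl).
have Ck : F [set i | C (a (g i) (p k))].
  exact: (glr _ _ (cvg_cst (p k)) (elimN eqP kr) _ Cl).
by apply: filterS2 Cj Ck => i Ci Di; exists j, k.
Qed.

Lemma closed_majority g l (C : set L) : closed C ->
  attracted F g l -> F [set i | majority C (g i)] -> C l.
Proof.
move=> cC /attracted_collapses[r glr] FC.
have Cl x : x <> r -> F [set i | C (a (g i) x)] -> C l.
  by move=> xr /(closed_cvg C cC); apply; exact: glr (cvg_cst x) xr.
have [|[j k] /= Fjk] := @ultra_exists I F UF ('I_3 * 'I_3)%type (fun jk =>
  [set i | [/\ jk.1 != jk.2, C (a (g i) (p jk.1)) & C (a (g i) (p jk.2))]]).
  by apply: filterS FC => i [j [k ?]]; exists (j, k).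
have [i [jk _ _]] := filter_ex Fjk.
have [jr|/eqP jr] := eqVneq (p j) r; last first.
  by apply: (Cl _ jr); apply: filterS Fjk => ? [].
have /eqP kr : p k != r by rewrite -jr (inj_eq p_inj) eq_sym.
by apply: (Cl _ kr); apply: filterS Fjk => ? [].
Qed.

End Attraction.

(** * The topology on the disjoint union *)

(** A continuous injection of a compact space into a Hausdorff space is closed
    onto its image. *)
Lemma compact_embedding (A X : topologicalType) (f : A -> X) :
  compact [set: A] -> hausdorff_space X -> continuous f -> injective f ->
  induces f.
Proof.
move=> cA hX cf fi U; split=> [oU|[V oV <-]]; last exact: open_comp oV.
exists (~` (f @` (~` U))).
  apply: closed_openC; apply: compact_closed => //.
  apply: continuous_compact; first exact: continuous_subspaceT.
  by apply: subclosed_compact cA _ => //; exact: open_closedC.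
apply/seteqP; split=> [x nUx|x Ux /= [y nUy /fi xy]]; last by rewrite xy in nUy.
by apply: contrapT => ?; apply: nUx; exists x.
Qed.

Section AttractorSum.
Context (G : topologicalGroupType) (Lambda Omega : topologicalType).
Context (aL : gaction G Lambda) (aO : gaction G Omega).
Context (hL : hausdorff_space Lambda) (cL : compact [set: Lambda]).
Context (p : 'I_3 -> Lambda) (p_inj : injective p).
Context (caL : continuous_action aL) (conv : convergence_property aL).
Context (hO : hausdorff_space Omega) (lcO : locally_compact [set: Omega]).
Context (caO : continuous_action aO) (pO : proper_action aO).
Context (K : set Omega) (cK : compact K).
Context (GK : [set aO g k | g in [set: G] & k in K] = [set: Omega]).

(** The ultrafilters quantified over are escaping by [attracted_escaping], so
    the last clause concerns only points of [Omega] near infinity. *)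
Definition attractor_open (U : set (Omega + Lambda)) :=
  [/\ open (inl @^-1` U), open (inr @^-1` U) &
    forall (F : set_system G) (l : Lambda), UltraFilter F ->
      attracted aL F id l -> U (inr l) ->
      F [set g | forall k, K k -> U (inl (aO g k))]].

Lemma attractor_openT : attractor_open [set: Omega + Lambda].
Proof.
by split; rewrite ?preimage_setT; try exact: openT; move=> *; exact: filterE.
Qed.

Lemma attractor_openI : setI_closed attractor_open.
Proof.
move=> U V [Ul Ur FU] [Vl Vr FV]; split; rewrite ?preimage_setI.
- exact: openI.
- exact: openI.
move=> F l UF Fl [Uil Vil].
apply: filterS2 (FU F l UF Fl Uil) (FV F l UF Fl Vil) => g gU gV k Kk.
by split; [exact: gU|exact: gV].
Qed.

Lemma attractor_open_bigcup (D : set (set (Omega + Lambda))) :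
  D `<=` attractor_open -> attractor_open (\bigcup_(U in D) U).
Proof.
move=> DU; split; rewrite ?preimage_bigcup.
- by apply: bigcup_open => U /DU[].
- by apply: bigcup_open => U /DU[].
move=> F l UF Fl [U DU' Ul]; have [_ _ FU] := DU U DU'.
by apply: filterS (FU F l UF Fl Ul) => g gU k Kk; exists U => //; exact: gU.
Qed.

Definition attractor_topology : topology_on (Omega + Lambda) :=
  TopologyOn attractor_openT attractor_openI attractor_open_bigcup.

Local Notation X := (topologized attractor_topology : topologicalType).
Local Notation il := (inl : Omega -> X).
Local Notation ir := (inr : Lambda -> X).
Local Notation aX := (sum_gaction aO aL : gaction G X).

Lemma inl_continuous : continuous il.
Proof. by apply/continuousP => U [oU _ _]. Qed.

Lemma inr_continuous : continuous ir.
Proof. by apply/continuousP => U [_ oU _]. Qed.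

Lemma inl_open (U : set Omega) : open U -> open (il @` U).
Proof.
move=> oU; split.
- rewrite -[X in open X]/(il @^-1` (il @` U)).
  suff -> : il @^-1` (il @` U) = U by [].
  by apply/seteqP; split=> [w [v Uv [<-]]|w Uw] //; exists w.
- suff -> : inr @^-1` (il @` U) = set0 :> set Lambda by exact: open0.
  by apply/seteqP; split=> [l [w]|].
- by move=> F l _ _ [w].
Qed.

Section Limits.
Context (I : Type) (F : set_system I) (UF : UltraFilter F).

(** How the third clause of [attractor_open] is used: points of [g K] tend to
    the attractor of [g]. *)
Lemma cvg_attracted (g : I -> G) (y : I -> X) (l : Lambda) :
  attracted aL F g l -> F [set i | exists2 k, K k & y i = inl (aO (g i) k)] ->
  y @ F --> ir l.
Proof.
move=> gl Fy U; rewrite nbhsE => -[V [oV Vl] VU]; rewrite nbhs_simpl /=.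
have [_ _ FV] := oV.
have Fg : F [set i | forall k, K k -> V (inl (aO (g i) k))].
  exact: (FV (g @ F) l (ultra_fmap UF g) gl Vl).
apply: filterS2 Fg Fy => i gV [k Kk yk].
by apply: VU; rewrite yk; exact: gV.
Qed.

(** The possible behaviors of a family along an ultrafilter: it stays in
    [Lambda], or it is [g k] with [k] in [K], where [g] either converges or
    escapes and then has an attractor. *)
Lemma attractor_sum_limits (y : I -> X) :
  (exists (y' : I -> Lambda) (l : Lambda),
     F [set i | y i = inr (y' i)] /\ y' @ F --> l) \/
  (exists (g : I -> G) (k : I -> Omega) (k0 : Omega),
     [/\ F [set i | K (k i)], F [set i | y i = inl (aO (g i) (k i))],
       k @ F --> k0 &
       (exists h : G, g @ F --> h) \/ (exists l, attracted aL F g l)]).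
Proof.
have [FL|FO] := in_ultra_setVsetC (y @^-1` range ir) UF; [left|right].
  pose y' i := if y i is inr l then l else p ord0.
  have [l y'l] := ultra_compactT_cvg UF y' cL.
  exists y', l; split=> //; apply: filterS FL => i [m _ ym].
  by rewrite /= /y' -ym.
have FO' : F [set i | exists w, y i = inl w].
  apply: filterS FO => i /=; case: (y i) => [w _|l nl]; first by exists w.
  by case: nl; exists l.
have [i0 [w0 _]] := filter_ex FO'.
have /choice[gk gkP] i : exists gk : G * Omega, forall w, y i = inl w ->
    K gk.2 /\ w = aO gk.1 gk.2.
  case yi : (y i) => [w|l]; last by exists (1%g, w0).
  have : [set: Omega] w by []; rewrite -GK => -[g _ [k Kk gkw]].
  by exists (g, k) => _ [<-].
have FK : F [set i | K (gk i).2] by apply: filterS FO' => i [w /gkP[]].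
have [k0 _ kk0] := ultra_compact_cvg UF cK FK.
exists (fun i => (gk i).1), (fun i => (gk i).2), k0; split=> //.
  by apply: filterS FO' => i [w yw]; rewrite /=; have [_ <-] := gkP _ _ yw.
have [eg|/(not_escaping UF)] := pselect (escaping F (fun i => (gk i).1)).
  by right; exact: (escaping_attracted p_inj conv UF eg).
by left.
Qed.

Lemma cvg_inl (y : I -> X) (y' : I -> Omega) (w : Omega) :
  F [set i | y i = inl (y' i)] -> y' @ F --> w -> y @ F --> il w.
Proof.
move=> yy' y'w; apply: cvg_near_eq yy' _.
exact: continuous_cvg (@inl_continuous w) y'w.
Qed.

Lemma cvg_inr (y : I -> X) (y' : I -> Lambda) (l : Lambda) :
  F [set i | y i = inr (y' i)] -> y' @ F --> l -> y @ F --> ir l.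
Proof.
move=> yy' y'l; apply: cvg_near_eq yy' _.
exact: continuous_cvg (@inr_continuous l) y'l.
Qed.

End Limits.

Lemma attractor_sum_compact : compact [set: X].
Proof.
rewrite compact_ultra => F UF _.
suff [x Fx] : exists x : X, id @ F --> x by exists x.
have [[y [l [Fy yl]]]|[g [k [k0 [FK Fy kk0 [[h gh]|[l gl]]]]]]] :=
  attractor_sum_limits UF (id : X -> X).
- by exists (ir l); exact: cvg_inr Fy yl.
- by exists (il (aO h k0)); apply: cvg_inl Fy _; exact: act_cvg gh kk0.
- exists (ir l); apply: cvg_attracted gl _.
  by apply: filterS2 FK Fy => x Kx xk; exists (k x).
Qed.

Lemma proper_return_compact (A B : set Omega) : compact A -> compact B ->
  exists2 Q : set G, compact Q & forall g w, A w -> B (aO g w) -> Q g.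
Proof.
move=> cA cB; have cM := pO (compact_setX cA cB).
exists (fst @` [set gp : G * Omega | (A `*` B) (gp.2, aO gp.1 gp.2)]).
  by apply: continuous_compact cM; apply: continuous_subspaceT => z; exact: cvg_fst.
by move=> g w Aw Bgw; exists (g, w).
Qed.

(** * Separation *)

Definition separated (x y : X) := exists U V : set X,
  [/\ open U, open V, U x, V y & U `&` V `<=` set0].

Lemma separated_sym x y : separated x y -> separated y x.
Proof.
move=> [U [V [oU oV Ux Vy UV]]]; exists V, U; split=> // z [Vz Uz].
exact: UV z (conj Uz Vz).
Qed.

Lemma separated_inl v w : v != w -> separated (inl v) (inl w).
Proof.
move: hO; rewrite open_hausdorff => h /h[[A B] /= [/set_mem Av /set_mem Bw]].
move=> [oA oB /eqP AB]; exists (il @` A), (il @` B); split.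
- exact: inl_open.
- exact: inl_open.
- by exists v.
- by exists w.
- move=> _ [[u Au <-] [u' Bu [uu']]]; rewrite uu' in Bu.
  by have : (A `&` B) u by []; rewrite AB.
Qed.

Lemma separated_inl_inr w l : separated (inl w) (inr l).
Proof.
have [N + [cN clN]] := lcO (x := w) I; rewrite withinET => Nw.
exists (il @` N^°), [set x | if x is inl v then ~ N v else True]; split=> //.
- by apply: inl_open; exact: open_interior.
- split.
  + exact: closed_openC clN.
  + exact: openT.
  + move=> F m UF Fm _.
    have [Q cQ QP] := proper_return_compact cK cN.
    have := ultra_notin UF (attracted_escaping hL caL UF Fm cQ).
    by apply: filterS => g nQg k Kk Ngk; apply: nQg; exact: QP Kk Ngk.
- by exists w.
- by move=> _ [[v Nv <-]] /=; apply; exact: interior_subset Nv.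
Qed.

(** A neighborhood in the sum of the interior points of [C]: to them are added
    the translates of [K'] by all [g] outside [Q] that test positive for [C]. *)
Definition shadow (K' : set Omega) (Q : set G) (C : set Lambda) : set X :=
  [set x | match x with
    | inl w => exists g, [/\ ~ Q g, majority aL p C g & K' (aO g^-1%g w)]
    | inr l => C^° l
  end].

Lemma shadow_open (K' : set Omega) (Q : set G) (C : set Lambda) :
  open K' -> K `<=` K' -> compact Q -> open (shadow K' Q C).
Proof.
move=> oK' KK' cQ; split.
- have -> : inl @^-1` shadow K' Q C =
      \bigcup_(g in [set g | ~ Q g /\ majority aL p C g])
        (fun w => aO g^-1%g w) @^-1` K'.
    by apply/seteqP; split=> w => [[g []]|[g []]]; exists g.
  apply: bigcup_open => g _; apply: open_comp oK' => w _.
  exact: (act_cvg caO (y := id) _ (cvg_cst _) cvg_id).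
- exact: open_interior.
- move=> F l UF Fl Cl.
  have FQ := ultra_notin UF (attracted_escaping hL caL UF Fl cQ).
  have FC := near_majority hL caL p_inj conv UF Fl Cl.
  apply: filterS2 FQ (FC : F _) => g nQg Cg k Kk; exists g; split=> //.
  by rewrite -Defs.gactM mulVg Defs.gact1; exact: KK'.
Qed.

(** Take disjoint closed neighborhoods [C] and [D] of the two points.  If a
    translate [g K'] by an element testing positive for [C] meets a translate
    [h K'] by an element testing positive for [D], then [g] belongs to the set
    [P] below.  No ultrafilter containing [P] escapes, as its attractor would
    lie in both [C] and [D]; so [P] lies in a compact set [Q'], and the shadows
    of [C] and [D] outside [Q'] are disjoint. *)
Lemma separated_inr l m : l != m -> separated (inr l) (inr m).
Proof.
move=> lm; have [C [D [Cl Dm clC clD CD]]] : exists C D : set Lambda,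
    [/\ nbhs l C, nbhs m D, closed C, closed D & C `&` D `<=` set0].
  move: hL; rewrite open_hausdorff => h.
  have [[A B] /= [/set_mem Al /set_mem Bm] [oA oB /eqP AB]] := h _ _ lm.
  have reg (x : Lambda) : {for x, regular_space Lambda}.
    exact: compact_regular hL cL filterT.
  have [C Cl CA] := reg l A (open_nbhs_nbhs (conj oA Al)).
  have [D Dm DB] := reg m B (open_nbhs_nbhs (conj oB Bm)).
  exists (closure C), (closure D); split; try exact: closed_closure.
  - by apply: filterS Cl; exact: subset_closure.
  - by apply: filterS Dm; exact: subset_closure.
  - by rewrite -AB; exact: setISS.
have [K' cK' KK'] := compact_sub_interior lcO cK.
have [Q cQ QP] := proper_return_compact cK' cK'.
pose P := [set g | majority aL p C g /\
  exists2 q, Q q & majority aL p D (g * q)%g].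
have [Q' cQ' PQ'] : exists2 Q', compact Q' & P `<=` Q'.
  apply: ultra_sub_directed.
  - by exists set0; exact: compact0.
  - by move=> V W cV cW; exists (V `|` W) => //; exact: compactU.
  move=> F UF FP; apply: contrapT => nQ.
  have eF : escaping F id by move=> V cV FV; apply: nQ; exists V.
  have [x Fx] := escaping_attracted p_inj conv UF eF.
  have /choice[q qP] (g : G) : exists q, P g -> Q q /\ majority aL p D (g * q)%g.
    have [[_ [q]]|nPg] := pselect (P g); first by exists q.
    by exists 1%g.
  have [q0 _ qq0] : exists2 q0, Q q0 & q @ F --> q0.
    by apply: (ultra_compact_cvg UF cQ); apply: filterS FP => g /qP[].
  have [r Fxr] := attracted_collapses hL caL conv UF Fx.
  have Fqx := collapses_mulr_cvg caL p_inj UF Fxr qq0.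
  apply: (CD x); split.
    apply: (closed_majority hL caL p_inj conv UF clC Fx).
    by apply: filterS FP => g [].
  apply: (closed_majority hL caL p_inj conv UF clD Fqx).
  by apply: filterS FP => g /qP[].
exists (shadow K'^° Q' C), (shadow K'^° Q' D); split.
- by apply: shadow_open => //; exact: open_interior.
- by apply: shadow_open => //; exact: open_interior.
- exact: Cl.
- exact: Dm.
move=> [w|x] /=; last first.
  by move=> [Cx Dx]; apply: (CD x); split; exact: interior_subset.
move=> [[g [nQg Cg gw]] [h [_ Dh hw]]].
apply: nQg; apply: PQ'; split=> //; exists (g^-1 * h)%g; last by rewrite mulKVg.
apply: (QP _ (aO h^-1%g w)); first exact: interior_subset.
rewrite -Defs.gactM mulgK; exact: interior_subset.
Qed.

Lemma attractor_sum_hausdorff : hausdorff_space X.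
Proof.
move=> x y xy; apply: contrapT => /eqP nxy.
suff [U [V [oU oV Ux Vy UV]]] : separated x y.
  have Ux' := open_nbhs_nbhs (conj oU Ux).
  have Vy' := open_nbhs_nbhs (conj oV Vy).
  by have [z /UV] := xy U V Ux' Vy'.
case: x y nxy {xy} => [v|l] [w|m] nxy.
- by apply: separated_inl; apply: contra_neq nxy => ->.
- exact: separated_inl_inr.
- exact/separated_sym/separated_inl_inr.
- by apply: separated_inr; apply: contra_neq nxy => ->.
Qed.


(** * The action on the sum *)

Lemma induces_inl : induces il.
Proof.
move=> U; split=> [oU|[V oV <-]].
  exists (il @` U); first exact: inl_open.
  by apply/seteqP; split=> [w [v Uv [<-]]|w Uw] //; exists w.
by apply: open_comp oV => w _; exact: inl_continuous.
Qed.

Lemma induces_inr : induces ir.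
Proof.
apply: compact_embedding cL attractor_sum_hausdorff inr_continuous _.
by move=> x y [].
Qed.

(** In the case of points [g k] with [g] escaping to [l] and [h] tending to
    [h0], the product [h g] is attracted to [h0 l]. *)
Lemma attractor_sum_continuous : continuous_action aX.
Proof.
move=> [h0 x0]; apply: continuous_at_ultra => F UF Fx.
pose h (i : G * X) := i.1; pose y (i : G * X) := i.2.
have hh : h @ F --> h0 by exact: cvg_comp Fx (cvg_fst (G := nbhs x0)).
have yx : y @ F --> x0 by exact: cvg_comp Fx (cvg_snd (F := nbhs h0)).
have hX := attractor_sum_hausdorff.
have [[y' [l [Fy yl]]]|[g [k [k0 [FK Fy kk0 [[g0 gg]|[l gl]]]]]]] :=
  attractor_sum_limits UF y.
- have -> : x0 = ir l by exact: cvg_ultra_hausdorff UF hX yx (cvg_inr UF Fy yl).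
  apply: (cvg_inr UF (y' := fun i => aL (h i) (y' i))).
    by apply: filterS Fy => i yi; rewrite /= -[i.2]/(y i) yi.
  exact: (act_cvg caL _ hh yl).
- have gk : (fun i => aO (g i) (k i)) @ F --> aO g0 k0 by exact: act_cvg gg kk0.
  have -> : x0 = il (aO g0 k0).
    exact: cvg_ultra_hausdorff UF hX yx (cvg_inl UF Fy gk).
  apply: (cvg_inl UF (y' := fun i => aO (h i) (aO (g i) (k i)))).
    by apply: filterS Fy => i yi; rewrite /= -[i.2]/(y i) yi.
  exact: (act_cvg caO _ hh gk).
- have FKy : F [set i | exists2 w, K w & y i = inl (aO (g i) w)].
    by apply: filterS2 FK Fy => i Ki yi; exists (k i).
  have -> : x0 = ir l.
    exact: cvg_ultra_hausdorff UF hX yx (cvg_attracted UF gl FKy).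
  apply: (cvg_attracted UF (attracted_mull caL UF hh gl)).
  apply: filterS FKy => i [w Kw yw]; exists w => //.
  by rewrite /= -[i.2]/(y i) yw /= Defs.gactM.
Qed.

(** The attractor and repeller are those of the action on [Lambda].  For points
    [q k] of [Omega] whose limit is not the repeller, two points of [Lambda]
    moved by [q] have limits other than the repeller; so [g] sends them to the
    attractor, [g q] is attracted there, and so is [g q k]. *)
Lemma attractor_sum_convergence : convergence_property aX.
Proof.
move=> I F g UF eg; have [l [r glr]] := conv UF eg.
exists (ir l), (ir r) => y y0 yy0 y0r.
have hX := attractor_sum_hausdorff.
have [[y' [m [Fy ym]]]|[q [k [k0 [FK Fy kk0 qlim]]]]] :=
  attractor_sum_limits UF y.
  have e : y0 = ir m by exact: cvg_ultra_hausdorff UF hX yy0 (cvg_inr UF Fy ym).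
  apply: (cvg_inr UF (y' := fun i => aL (g i) (y' i))).
    by apply: filterS Fy => i /= ->.
  by apply: glr ym _ => mr; apply: y0r; rewrite e mr.
have FKy : F [set i | exists2 w, K w & y i = inl (aO (q i) w)].
  by apply: filterS2 FK Fy => i Ki yi; exists (k i).
have gq : attracted aL F (fun i => g i * q i)%g l.
  case: qlim => [[q0 qq0]|[m qm]].
    exact: (collapses_mulr_cvg caL p_inj UF glr qq0).
  have e : y0 = ir m.
    exact: cvg_ultra_hausdorff UF hX yy0 (cvg_attracted UF qm FKy).
  have mr : m <> r by move=> mr; apply: y0r; rewrite e mr.
  by case: qm => [u [v [uv qu qv]]]; exact: (attracted_mulr glr uv qu mr qv mr).
apply: (cvg_attracted UF gq).
by apply: filterS FKy => i [w Kw /= ->]; exists w; rewrite //= Defs.gactM.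
Qed.

Lemma attractor_sum_proper : proper_on_triples aX.
Proof.
exact: convergence_proper attractor_sum_hausdorff attractor_sum_continuous
  attractor_sum_convergence.
Qed.

(** * Uniqueness *)

Section Uniqueness.
Context (sigma : topology_on (Omega + Lambda)).
Local Notation Y := (topologized sigma : topologicalType).
Local Notation aY := (sum_gaction aO aL : gaction G Y).
Context (hY : hausdorff_space Y).
Context (inl_ind : induces (inl : Omega -> Y)).
Context (inr_ind : induces (inr : Lambda -> Y)).
Context (convY : convergence_property aY).

Lemma sigma_cvg_inr (I : Type) (F : set_system I) (y : I -> Lambda) (l : Lambda) :
  Filter F -> y @ F --> l -> (fun i => inr (y i) : Y) @ F --> (inr l : Y).
Proof.
move=> FF yl; apply: (@continuous_cvg _ _ _ F FF y (inr : Lambda -> Y) l) yl.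
by move: l; apply/continuousP => U oU; apply/inr_ind; exists U.
Qed.

(** The attractor is the limit of a point of [Lambda], so it lies in [Lambda].
    So does the repeller: if [z] in [Lambda] is not the attractor, then [g^-1 z]
    is moved to [z], so its limit, a point of [Lambda], is the repeller. *)
Lemma sigma_attracted_collapses (F : set_system G) (l : Lambda) : UltraFilter F ->
  attracted aL F id l -> exists r, collapses aY F id (inr l : Y) (inr r : Y).
Proof.
move=> UF Fl; have [l' [r' lr']] := convY UF (attracted_escaping hL caL UF Fl).
have l'l : l' = inr l.
  case: Fl => x [y [xy gx gy]].
  have lim z : (fun g => aL g z) @ F --> l -> (inr z : Y) <> r' -> l' = inr l.
    move=> gz zr; apply: (cvg_ultra_hausdorff UF hY _ (sigma_cvg_inr _ gz)).
    exact: lr' (cvg_cst (inr z : Y)) zr.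
  have [xr|] := pselect ((inr x : Y) = r'); last exact: lim.
  by apply: (lim y gy) => yr; move/eqP: xy; apply; move: xr; rewrite -yr => -[].
have [i [_ [_ il _]]] := two_of_three p_inj l.
have [r gr] := ultra_compactT_cvg UF (fun g => aL g^-1%g (p i)) cL.
exists r; suff -> : (inr r : Y) = r' by rewrite -l'l.
apply: contrapT => rr'; move/eqP: il; apply.
have FF : Filter F by typeclasses eauto.
have := lr' _ _ (sigma_cvg_inr FF gr) rr'; rewrite l'l => lim.
suff [] : (inr (p i) : Y) = inr l by [].
apply: (cvg_ultra_hausdorff UF hY _ lim).
apply: cvg_near_eq (cvg_cst (inr (p i) : Y)).
by apply: filterE => g /=; rewrite -Defs.gactM mulgV Defs.gact1.
Qed.

(** Otherwise, for almost all [g], some point [y] of [K] is moved out of [U];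
    but [y] has a limit in [K], which is not the repeller, so [g y] tends to
    the attractor, a point of [U]. *)
Lemma attractor_topology_finer : opens sigma `<=` opens attractor_topology.
Proof.
move=> U oU; split.
- by apply/inl_ind; exists U.
- by apply/inr_ind; exists U.
move=> F l UF Fl Ul; apply: contrapT => nFU.
have [r lr] := sigma_attracted_collapses UF Fl.
have /choice[y yP] (g : G) : exists y : Y,
    (exists2 k, K k & ~ U (inl (aO g k))) ->
    (exists2 k, K k & inl k = y) /\ ~ U (aY g y).
  have [[k Kk nUk]|nk] := pselect (exists2 k, K k & ~ U (inl (aO g k))).
    by exists (inl k) => _; split=> //; exists k.
  by exists (inr l).
have FnU : F [set g | exists2 k, K k & ~ U (inl (aO g k))].
  apply: filterS (ultra_notin UF nFU) => g ng; apply: contrapT => nk.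
  by apply: ng => k Kk; apply: contrapT => nUk; apply: nk; exists k.
have cinl : compact ((inl : Omega -> Y) @` K).
  apply: continuous_compact cK; apply: continuous_subspaceT.
  by apply/continuousP => V oV; apply/inl_ind; exists V.
have [y0 [k _ ky0] yy0] : exists2 y0, ((inl : Omega -> Y) @` K) y0 & y @ F --> y0.
  by apply: (ultra_compact_cvg UF cinl); apply: filterS FnU => g /yP[].
have y0r : y0 <> inr r by rewrite -ky0.
have FU : F [set g | U (aY g (y g))].
  by apply: (lr _ _ yy0 y0r); apply: open_nbhs_nbhs.
by have [g [/yP[_ ?]]] := filter_ex (filterI FnU FU).
Qed.

Lemma attractor_topology_unique : attractor_topology = sigma.
Proof.
apply: topology_on_ext; apply/seteqP; split; last exact: attractor_topology_finer.
have idc : continuous (id : X -> Y).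
  by apply/continuousP => U; exact: attractor_topology_finer.
have := compact_embedding attractor_sum_compact hY idc (@inj_id _).
by move=> ind U /(ind U)[V oV <-].
Qed.

End Uniqueness.

End AttractorSum.

Theorem proposition8p3p1 (G : topologicalGroupType)
    (Lambda Omega : topologicalType)
    (aLambda : gaction G Lambda) (aOmega : gaction G Omega) :
  hausdorff_space G -> locally_compact [set: G] ->
  hausdorff_space Lambda -> compact [set: Lambda] ->
  [set: 'I_3] #<= [set: Lambda] ->
  continuous_action aLambda -> proper_on_triples aLambda ->
  hausdorff_space Omega -> locally_compact [set: Omega] ->
  continuous_action aOmega -> proper_action aOmega ->
  cocompact_action aOmega ->
  exists! tau : topology_on (Omega + Lambda),
    let X : topologicalType := topologized tau in
    let aX : gaction G X := sum_gaction aOmega aLambda in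
    [/\ compact [set: X] /\ hausdorff_space X,
        induces (inl : Omega -> X),
        induces (inr : Lambda -> X),
        continuous_action aX
      & proper_on_triples aX].
Proof.
move=> _ _ hL cL card3 caL pL hO lcO caO pO [K [cK GK]].
have [p p_inj] : exists p : 'I_3 -> Lambda, injective p.
  have /card_leP[f] := card3.
  exists (fun i => val (f (SigSub (mem_set (I : [set: 'I_3] i))))) => i j /val_inj.
  by move=> /(inj _ _) e; have := e (mem_set I) (mem_set I) => -[].
have conv := proper_convergence hL p_inj cL pL.
exists (attractor_topology aLambda aOmega K); split.
  split.
  - split; first exact: (attractor_sum_compact cL p_inj conv caO cK GK).
    exact: (attractor_sum_hausdorff hL cL p_inj caL conv hO lcO caO pO cK).
  - exact: induces_inl.
  - exact: (induces_inr hL cL p_inj caL conv hO lcO caO pO cK).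
  - exact: (attractor_sum_continuous hL cL p_inj caL conv hO lcO caO pO cK GK).
  - exact: (attractor_sum_proper hL cL p_inj caL conv hO lcO caO pO cK GK).
move=> sigma /= [[cY hY] indl indr caY pY].
apply: (attractor_topology_unique hL cL p_inj caL conv caO cK GK hY indl indr).
have q_inj : injective (inr \o p : 'I_3 -> topologized sigma).
  by move=> i j [/p_inj].
exact: (proper_convergence hY q_inj cY pY).
Qed.
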